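(* Let $(\mathfrak{h},[\,,]_{\mathfrak{h}})$ be a $2$-step nilpotent real Lie algebra. Let $\mathfrak{h}_{\overline{\mathbb{C}}}$ be the real vector space $\mathfrak{h}\otimes_{\mathbb{R}}\mathbb{C}$ equipped with the real-bilinear bracket and the endomorphism $J_{\mathfrak{h}}$ determined by $$[X\otimes a,Y\otimes b]=[X,Y]_{\mathfrak{h}}\otimes\overline{ab},\qquad J_{\mathfrak{h}}(X\otimes a)=X\otimes i a,$$ for $X,Y\in\mathfrak{h}$ and $a,b\in\mathbb{C}$. Then $(\mathfrak{h}_{\overline{\mathbb{C}}},J_{\mathfrak{h}})$ is a quasi-Kähler Chern-flat Lie algebra.
   Context: An almost complex Lie algebra $(\mathfrak{g},J)$ is a finite-dimensional real Lie algebra $\mathfrak{g}$ with an endomorphism $J$ satisfying $J^2=-\mathrm{I}$. Let $\mathfrak{g}\otimes\mathbb{C}=\mathfrak{g}^{1,0}\oplus\mathfrak{g}^{0,1}$ be the splitting into the $\pm i$-eigenspaces of $J$. $(\mathfrak{g},J)$ is called quasi-Kähler Chern-flat if $[\mathfrak{g}^{1,0},\mathfrak{g}^{0,1}]=0$ and $[\mathfrak{g}^{1,0},\mathfrak{g}^{1,0}]\subseteq\mathfrak{g}^{0,1}$ (with the bracket extended complex-bilinearly to $\mathfrak{g}\otimes\mathbb{C}$). A Lie algebra $\mathfrak{h}$ is $2$-step nilpotent if $[[\mathfrak{h},\mathfrak{h}],\mathfrak{h}]=0$. All Lie algebras are finite-dimensional. *)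

(* Defs.v *)
From HB Require Import structures.
From mathcomp Require Import all_boot all_order all_algebra.
From mathcomp Require Import complex reals.

Set Implicit Arguments.
Unset Strict Implicit.
Unset Printing Implicit Defensive.

Import GRing.Theory Num.Theory.
Local Open Scope ring_scope.
Local Open Scope complex_scope.

Section LieAlgebras.
Variables (K : fieldType) (g : vectType K).

Record lie_bracket (br : g -> g -> g) : Prop := LieBracket {
  lie_bilinear : bilinear_for *:%R *:%R br;
  lie_alternating : forall x, br x x = 0;
  lie_jacobi : forall x y z,
    br x (br y z) + br y (br z x) + br z (br x y) = 0
}.

(* [[g, g], g] = 0; abelian algebras are included. *)
Definition two_step_nilpotent (br : g -> g -> g) : Prop :=
  forall x y z, br (br x y) z = 0.

Record almost_complex (br : g -> g -> g) (J : 'End(g)) : Prop :=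
  AlmostComplex {
  almost_complex_lie : lie_bracket br;
  almost_complex_sqr : (J \o J)%VF = - \1%VF
}.

End LieAlgebras.

Section BilinearOn.
Variables (K : fieldType) (U U' W : lmodType K) (f : U -> U' -> W).
Hypothesis fB : bilinear_for *:%R *:%R f.

Lemma bil_lin_l a x y u : f (a *: x + y) u = a *: f x u + f y u.
Proof. exact: (fB.1 u a x y). Qed.

Lemma bil_lin_r a u x y : f u (a *: x + y) = a *: f u x + f u y.
Proof. exact: (fB.2 u a x y). Qed.

Lemma bil_Dl x y u : f (x + y) u = f x u + f y u.
Proof. by have := bil_lin_l 1 x y u; rewrite !scale1r. Qed.

Lemma bil_Dr u x y : f u (x + y) = f u x + f u y.
Proof. by have := bil_lin_r 1 u x y; rewrite !scale1r. Qed.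

Lemma bil_0l u : f 0 u = 0.
Proof. by apply: (addrI (f 0 u)); rewrite -bil_Dl !addr0. Qed.

Lemma bil_0r u : f u 0 = 0.
Proof. by apply: (addrI (f u 0)); rewrite -bil_Dr !addr0. Qed.

Lemma bil_Zl a x u : f (a *: x) u = a *: f x u.
Proof. by rewrite -[a *: x]addr0 bil_lin_l bil_0l addr0. Qed.

Lemma bil_Zr a u x : f u (a *: x) = a *: f u x.
Proof. by rewrite -[a *: x]addr0 bil_lin_r bil_0r addr0. Qed.

End BilinearOn.

(* The real vector space V ⊗_R C: the pair (x, y) stands for x⊗1 + y⊗i.
   [otimes_universal] is the universal property of the tensor product. *)
Definition tensorC (R : realType) (V : vectType R) : Type := (V * V)%type.

HB.instance Definition _ (R : realType) (V : vectType R) :=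
  Vector.copy (tensorC V) (V * V)%type.

Section TensorC.
Variables (R : realType) (V : vectType R).

Lemma tensorC_eq (z w : tensorC V) : z.1 = w.1 -> z.2 = w.2 -> z = w.
Proof. exact: injective_projections. Qed.

Definition otimes (x : V) (a : R[i]) : tensorC V :=
  (complex.Re a *: x, complex.Im a *: x).

(* [Rcomplex R] is R[i] viewed as a real vector space. *)
Lemma otimes_bilinear :
  bilinear_for *:%R *:%R (otimes : V -> Rcomplex R -> tensorC V).
Proof.
split=> [a k x y|x k a b]; apply: tensorC_eq => /=.
- by rewrite scalerDr !scalerA mulrC.
- by rewrite scalerDr !scalerA mulrC.
- by case: a b => [? ?] [? ?] /=; rewrite scalerDl scalerA.
- by case: a b => [? ?] [? ?] /=; rewrite scalerDl scalerA.
Qed.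

Lemma otimes_decomp (z : tensorC V) : z = otimes z.1 1 + otimes z.2 'i.
Proof.
by apply: tensorC_eq; rewrite /= ?scale1r ?scale0r ?addr0 ?add0r.
Qed.

Lemma otimes_universal (W : lmodType R) (f : V -> Rcomplex R -> W) :
  bilinear_for *:%R *:%R f ->
  exists g : tensorC V -> W,
    [/\ linear g, (forall x a, g (otimes x a) = f x a) &
        forall g' : tensorC V -> W, linear g' ->
          (forall x a, g' (otimes x a) = f x a) -> g' =1 g].
Proof.
move=> fB; exists (fun z => f z.1 1 + f z.2 'i); split.
- by move=> k z w /=; rewrite !(bil_lin_l fB) scalerDr addrACA.
- move=> x [a b] /=; rewrite !(bil_Zl fB) -!(bil_Zr fB) -(bil_Dr fB).
  by congr (f x (Complex _ _)); rewrite /= ?mulr0 ?mulr1 ?addr0 ?add0r.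
- move=> g' lg' g'E z; rewrite {1}(otimes_decomp z).
  by have := lg' 1 (otimes z.1 1) (otimes z.2 'i); rewrite !scale1r !g'E.
Qed.

(* Multiplication by i on the second factor, [otimesJE]. *)
Definition tensorJ_fun (z : tensorC V) : tensorC V :=
  otimes z.1 ('i * 1) + otimes z.2 ('i * 'i).

Lemma tensorJ_funE z : tensorJ_fun z = (- z.2, z.1).
Proof.
apply: tensorC_eq;
by rewrite /= !(mulr0, mulr1, mul0r, mul1r, subr0, sub0r, addr0, add0r, oppr0,
                scale0r, scale1r, scaleN1r).
Qed.

Fact tensorJ_linear : linear tensorJ_fun.
Proof.
move=> k z w; rewrite !tensorJ_funE; apply: tensorC_eq => //=.
by rewrite opprD scalerN.
Qed.

HB.instance Definition _ := GRing.isLinear.Build R (tensorC V) (tensorC V) _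
  tensorJ_fun tensorJ_linear.

Definition tensorJ : 'End(tensorC V) := linfun tensorJ_fun.

Lemma otimesJE x a : tensorJ (otimes x a) = otimes x ('i * a).
Proof.
rewrite lfunE /= tensorJ_funE; case: a => a b.
by apply: tensorC_eq;
  rewrite /= !(mul0r, mul1r, sub0r, add0r, scaleNr).
Qed.

Lemma tensorJ_unique (J : 'End(tensorC V)) :
  (forall x a, J (otimes x a) = otimes x ('i * a)) -> J = tensorJ.
Proof.
move=> JE; apply/lfunP => z.
by rewrite (otimes_decomp z) !linearD /= !JE !otimesJE.
Qed.

(* Bilinear extension of [x⊗a, y⊗b] = [x, y]⊗conj(ab) from a, b in {1, i}. *)
Definition conj_bracket (br : V -> V -> V) (z w : tensorC V) : tensorC V :=
  otimes (br z.1 w.1) (1 * 1)^* + otimes (br z.1 w.2) (1 * 'i)^* +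
  otimes (br z.2 w.1) ('i * 1)^* + otimes (br z.2 w.2) ('i * 'i)^*.

Section ConjBracket.
Variable br : V -> V -> V.

Lemma conj_bracket_pair z w : conj_bracket br z w =
  (br z.1 w.1 - br z.2 w.2, - (br z.1 w.2 + br z.2 w.1)).
Proof.
apply: tensorC_eq;
by rewrite /= !(mulr0, mulr1, mul0r, mul1r, subr0, sub0r, addr0, add0r, oppr0,
                scale0r, scale1r, scaleN1r) ?opprD.
Qed.

Hypothesis brB : bilinear_for *:%R *:%R br.

Lemma conj_bracket_bilinear : bilinear_for *:%R *:%R (conj_bracket br).
Proof.
split=> [w k z z'|z k w w']; apply: tensorC_eq;
rewrite !conj_bracket_pair /=
  ?(bil_Dl brB) ?(bil_Zl brB) ?(bil_Dr brB) ?(bil_Zr brB).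
- by rewrite scalerBr opprD addrACA.
- by rewrite scalerN scalerDr -opprD addrACA.
- by rewrite scalerBr opprD addrACA.
- by rewrite scalerN scalerDr -opprD addrACA.
Qed.

Lemma conj_bracketE x y a b :
  conj_bracket br (otimes x a) (otimes y b) = otimes (br x y) (a * b)^*.
Proof.
case: a b => [a a'] [b b'].
by apply: tensorC_eq;
  rewrite conj_bracket_pair /= !(bil_Zl brB) !(bil_Zr brB)
          !scalerA -?scalerBl -?scalerDl -?scaleNr.
Qed.

Lemma conj_bracket_unique (f : tensorC V -> tensorC V -> tensorC V) :
  bilinear_for *:%R *:%R f ->
  (forall x y a b, f (otimes x a) (otimes y b) = otimes (br x y) (a * b)^*) ->
  forall z w, f z w = conj_bracket br z w.
Proof.
move=> fB fE z w; rewrite {1}(otimes_decomp z) {1}(otimes_decomp w).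
by rewrite !(bil_Dl fB) !(bil_Dr fB) !fE !addrA.
Qed.

End ConjBracket.

End TensorC.

(* The same space V ⊗_R C, as a complex vector space. *)
Definition complexification (R : realType) (V : vectType R) : Type :=
  tensorC V.

Section Complexification.
Import VectorInternalTheory.
Variables (R : realType) (V : vectType R).
Local Notation VC := (complexification V).

HB.instance Definition _ := GRing.Zmodule.copy VC (tensorC V).

Lemma complexification_eq (z w : VC) : z.1 = w.1 -> z.2 = w.2 -> z = w.
Proof. exact: injective_projections. Qed.

Definition cscale (c : R[i]) (z : VC) : VC :=
  (complex.Re c *: z.1 - complex.Im c *: z.2,
   complex.Im c *: z.1 + complex.Re c *: z.2).

Fact cscaleA a b z : cscale a (cscale b z) = cscale (a * b) z.
Proof.
case: a b => [a a'] [b b']; apply: complexification_eq;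
  rewrite /= !scalerDr ?scalerN !scalerA !scalerDl ?scaleNr ?opprD.
- by rewrite addrACA.
- by rewrite addrACA; congr (_ + _); rewrite addrC.
Qed.

Fact cscale1 : left_id 1 cscale.
Proof.
by move=> z; apply: complexification_eq;
  rewrite /= !scale1r !scale0r ?subr0 ?add0r.
Qed.

Fact cscaleDr : right_distributive cscale +%R.
Proof.
by move=> c z w; apply: complexification_eq;
  rewrite /= !scalerDr ?opprD addrACA.
Qed.

Fact cscaleDl z : {morph cscale^~ z : a b / a + b}.
Proof.
by move=> [a a'] [b b']; apply: complexification_eq;
  rewrite /= !scalerDl ?opprD addrACA.
Qed.

HB.instance Definition _ := GRing.Zmodule_isLmodule.Build R[i] VC
  cscaleA cscale1 cscaleDr cscaleDl.

Lemma cscale_otimes (c : R[i]) x a :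
  c *: (otimes x a : VC) = otimes x (c * a) :> VC.
Proof.
case: c a => [c c'] [a a']; apply: complexification_eq => /=.
  by rewrite !scalerA -scalerBl.
by rewrite !scalerA -scalerDl addrC.
Qed.

Fact complexification_vect_axiom : Vector.axiom (dim V) VC.
Proof.
pose c2r (z : VC) : 'rV[R[i]]_(dim V) :=
  \row_j Complex (v2r z.1 0 j) (v2r z.2 0 j).
pose r2c (u : 'rV[R[i]]_(dim V)) : VC :=
  (r2v (\row_j complex.Re (u 0 j)), r2v (\row_j complex.Im (u 0 j))).
exists c2r.
  move=> [c c'] z w; apply/rowP=> j; rewrite !mxE /= !linearD linearN.
  rewrite !linearZ !mxE /=.
  by apply/eqP; rewrite eq_complex /= mulrN [c * v2r z.2 0 j + _]addrC !eqxx.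
exists r2c => [z|u].
  apply: complexification_eq; rewrite /= -[RHS]v2rK; congr r2v;
  by apply/rowP=> j; rewrite !mxE.
by apply/rowP=> j; rewrite !mxE /= !r2vK !mxE; case: (u 0 j).
Qed.

HB.instance Definition _ := Lmodule_hasFinDim.Build R[i] VC
  complexification_vect_axiom.

Definition of_real (x : V) : VC := otimes x 1.

Lemma complexification_decomp (z : VC) :
  z = of_real z.1 + 'i *: of_real z.2.
Proof.
rewrite /of_real cscale_otimes mulr1; exact: otimes_decomp.
Qed.

(* The C-linear extension of a real endomorphism. *)
Definition cext_fun (J : 'End(V)) (z : VC) : VC := (J z.1, J z.2).

Fact cext_linear J : linear (cext_fun J).
Proof.
move=> [c c'] z w; apply: complexification_eq;
by rewrite /= !linearD /= ?linearN /= !linearZ.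
Qed.

HB.instance Definition _ J := GRing.isLinear.Build R[i] VC VC _
  (cext_fun J) (cext_linear J).

Definition cext (J : 'End(V)) : 'End(VC) := linfun (cext_fun J).

Lemma cextE J x : cext J (of_real x) = of_real (J x).
Proof.
by rewrite lfunE /=; apply: complexification_eq; rewrite /= linearZ.
Qed.

(* The C-bilinear extension of a real bilinear map. *)
Definition cbracket (br : V -> V -> V) (z w : VC) : VC :=
  (br z.1 w.1 - br z.2 w.2, br z.1 w.2 + br z.2 w.1).

Section CBracket.
Variable br : V -> V -> V.
Hypothesis brB : bilinear_for *:%R *:%R br.

Lemma cbracketE x y :
  cbracket br (of_real x) (of_real y) = of_real (br x y).
Proof.
apply: complexification_eq; rewrite /= !scale1r !scale0r.
  by rewrite (bil_0l brB) subr0.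
by rewrite (bil_0l brB) (bil_0r brB) addr0.
Qed.

Lemma cbracket_bilinear : bilinear_for *:%R *:%R (cbracket br).
Proof.
have bNl x y : br (- x) y = - br x y by rewrite -scaleN1r (bil_Zl brB) scaleN1r.
have bNr x y : br x (- y) = - br x y by rewrite -scaleN1r (bil_Zr brB) scaleN1r.
have addr4 (a b c d e f : V) :
    (a + b + e) + (c + d + f) = (a + c + (b + d)) + (e + f).
  by rewrite addrACA [a + b + _]addrACA.
split=> [w [c c'] z z'|z [c c'] w w']; apply: complexification_eq => /=;
  rewrite ?(bil_Dl brB) ?(bil_Dr brB) ?bNl ?bNr
          ?(bil_Zl brB) ?(bil_Zr brB) ?opprD addr4; congr (_ + _);
  rewrite !scalerDr ?scalerN ?opprD ?opprK.
- by rewrite [X in _ + X = _]addrC addrACA.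
- by rewrite [X in X + _ = _]addrC addrACA.
- by rewrite [X in _ + X = _]addrC addrACA [X in _ + X = _]addrC.
- by rewrite [X in _ + X = _]addrC addrACA [X in _ + X = _]addrC.
Qed.

Lemma cbracket_unique (f : VC -> VC -> VC) :
  bilinear_for *:%R *:%R f ->
  (forall x y, f (of_real x) (of_real y) = of_real (br x y)) ->
  forall z w, f z w = cbracket br z w.
Proof.
move=> fB fE z w; rewrite (complexification_decomp z) (complexification_decomp w).
rewrite !(bil_Dl fB) !(bil_Dr fB) !(bil_Zl fB) !(bil_Zr fB) !fE.
rewrite !(bil_Dl cbracket_bilinear) !(bil_Dr cbracket_bilinear).
by rewrite !(bil_Zl cbracket_bilinear) !(bil_Zr cbracket_bilinear) !cbracketE.
Qed.

End CBracket.

End Complexification.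

Section QuasiKaehler.
Variables (R : realType) (g : vectType R).

Definition g10 (J : 'End(g)) : {vspace complexification g} :=
  passmx.leigenspace (cext J) 'i.

Definition g01 (J : 'End(g)) : {vspace complexification g} :=
  passmx.leigenspace (cext J) (- 'i).

Record quasi_Kaehler_Chern_flat (br : g -> g -> g) (J : 'End(g)) : Prop :=
  QuasiKaehlerChernFlat {
  qkcf_almost_complex : almost_complex br J;
  qkcf_mixed : forall u v, u \in g10 J -> v \in g01 J -> cbracket br u v = 0;
  qkcf_holomorphic : forall u v, u \in g10 J -> v \in g10 J ->
    cbracket br u v \in g01 J
}.

End QuasiKaehler.

(* Main.v *)
Require Import Defs.
From mathcomp Require Import all_boot all_order all_algebra.
From mathcomp Require Import complex reals.

(** The map z |-> [z, w] on the conjugate complexification is antilinear for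
    multiplication by i, because [X⊗ia, Y⊗b] = [X, Y]⊗conj(iab) =
    - i [X⊗a, Y⊗b]; that is, [J z, w] = - J [z, w], and likewise in w
    ([conj_bracket_antilinear_l], [conj_bracket_antilinear_r]).  Both
    identities pass to the C-bilinear extensions of the bracket and of J.  If
    now J u = i u, then i [u, v] = - J [u, v] for every v, so that [u, v] lies
    in the (-i)-eigenspace.  If moreover J v = - i v, then the same computation
    in the second argument puts [u, v] in the i-eigenspace as well, hence
    [u, v] = 0 ([antilinear_bracket_quasi_Kaehler_Chern_flat]).

    What remains is that conj_bracket is a Lie bracket.  It inherits
    skew-symmetry from [,]_h, since conj(ab) is symmetric in a and b.  The
    Jacobi identity is where nilpotency enters: conj(a conj(bc)) is not
    invariant under cyclic permutations of a, b and c, so the Jacobi identity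
    of h would not suffice, but in a 2-step nilpotent algebra each of its three
    terms vanishes ([conj_bracket_lie]). *)

Set Implicit Arguments.
Unset Strict Implicit.
Unset Printing Implicit Defensive.

Import GRing.Theory Num.Theory.
Local Open Scope ring_scope.
Local Open Scope complex_scope.

Lemma bil_Nl (K : fieldType) (U U' W : lmodType K) (f : U -> U' -> W) :
  bilinear_for *:%R *:%R f -> forall x y, f (- x) y = - f x y.
Proof. by move=> fB x y; rewrite -scaleN1r (bil_Zl fB) scaleN1r. Qed.

Lemma alternating_anticomm (K : fieldType) (U W : lmodType K) (f : U -> U -> W) :
  bilinear_for *:%R *:%R f -> (forall x, f x x = 0) ->
  forall x y, f x y = - f y x.
Proof.
move=> fB fA x y; apply/eqP; rewrite -addr_eq0; apply/eqP.
have := fA (x + y).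
by rewrite (bil_Dl fB) !(bil_Dr fB) !fA add0r addr0.
Qed.

Lemma leigenspaceP (K : fieldType) (V : vectType K) (f : 'End(V)) a v :
  reflect (f v = a *: v) (v \in passmx.leigenspace f a).
Proof.
rewrite memv_ker add_lfunE opp_lfunE scale_lfunE id_lfunE subr_eq0; exact: eqP.
Qed.

Section AntilinearBracket.
Variables (R : realType) (g : vectType R) (br : g -> g -> g) (J : 'End(g)).

Lemma cext_pair z : cext J z = (J z.1, J z.2).
Proof. by rewrite lfunE. Qed.

Lemma cbracket_antilinear_l :
  (forall x y, br (J x) y = - J (br x y)) ->
  forall u v, cbracket br (cext J u) v = - cext J (cbracket br u v).
Proof.
move=> JN u v; rewrite !cext_pair; apply: complexification_eq => /=;
by rewrite !JN ?linearB ?linearD.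
Qed.

Lemma cbracket_antilinear_r :
  (forall x y, br x (J y) = - J (br x y)) ->
  forall u v, cbracket br u (cext J v) = - cext J (cbracket br u v).
Proof.
move=> JN u v; rewrite !cext_pair; apply: complexification_eq => /=;
by rewrite !JN ?linearB ?linearD.
Qed.

(** A bracket of u in g10 with any v is a (-i)-eigenvector by antilinearity in
    u, and one of any u with v in g01 is an i-eigenvector by antilinearity in
    v; a mixed bracket therefore lies in two eigenspaces that meet in 0. *)
Lemma antilinear_bracket_quasi_Kaehler_Chern_flat :
  almost_complex br J ->
  (forall x y, br (J x) y = - J (br x y)) ->
  (forall x y, br x (J y) = - J (br x y)) ->
  quasi_Kaehler_Chern_flat br J.
Proof.
move=> acJ JNl JNr.
have cB := cbracket_bilinear (lie_bilinear (almost_complex_lie acJ)).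
have br10 u v : u \in g10 J -> cext J (cbracket br u v) = - 'i *: cbracket br u v.
  move=> /leigenspaceP Ju.
  rewrite -[LHS]opprK -cbracket_antilinear_l // Ju.
  by rewrite (bil_Zl cB) scaleNr.
have br01 u v : v \in g01 J -> cext J (cbracket br u v) = 'i *: cbracket br u v.
  move=> /leigenspaceP Jv.
  rewrite -[LHS]opprK -cbracket_antilinear_r // Jv.
  by rewrite (bil_Zr cB) scaleNr opprK.
split=> [|u v u10 v01|u v u10 _]; first exact: acJ.
  have /eqP := br10 u v u10; rewrite (br01 _ _ v01) -subr_eq0 -scalerBl.
  (* The eigenvalues differ by the nonzero scalar 2i. *)
  rewrite scaler_eq0 => /orP[|/eqP //].
  by rewrite eq_complex /= !opprK -[1 + 1]/(2%:R) pnatr_eq0 andbF.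
exact/leigenspaceP/br10.
Qed.

End AntilinearBracket.

Section ConjBracket.
Variables (R : realType) (h : vectType R) (br : h -> h -> h).
Hypothesis br_lie : lie_bracket br.

(** Both components of [[x, y], z] are, up to sign, sums of double brackets
    of h. *)
Lemma conj_bracket_two_step_nilpotent :
  two_step_nilpotent br -> two_step_nilpotent (conj_bracket br).
Proof.
have brB := lie_bilinear br_lie.
move=> nil x y z; rewrite !conj_bracket_pair /=.
by rewrite !(bil_Dl brB, bil_Nl brB) !nil !(oppr0, addr0).
Qed.

Lemma conj_bracket_alternating z : conj_bracket br z z = 0.
Proof.
have [brB brA _] := br_lie.
by rewrite conj_bracket_pair !brA subr0 (alternating_anticomm brB brA z.1) addNr oppr0.
Qed.

(** Jacobi for (X⊗i, Y⊗1, Z⊗1) amounts, given Jacobi for h, to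
    [X, [Y, Z]] = 0: it holds term by term or not at all. *)
Lemma conj_bracket_lie :
  two_step_nilpotent br -> lie_bracket (conj_bracket br).
Proof.
move=> nil; have cB := conj_bracket_bilinear (lie_bilinear br_lie).
have anti := alternating_anticomm cB conj_bracket_alternating.
have nilr x y z : conj_bracket br x (conj_bracket br y z) = 0.
  by rewrite anti conj_bracket_two_step_nilpotent ?oppr0.
by split=> // [|x y z]; [exact: conj_bracket_alternating | rewrite !nilr !addr0].
Qed.

Lemma conj_bracket_antilinear_l x y :
  conj_bracket br (tensorJ h x) y = - tensorJ h (conj_bracket br x y).
Proof.
have brB := lie_bilinear br_lie.
rewrite !lfunE /= !tensorJ_funE !conj_bracket_pair.
by apply: tensorC_eq; rewrite /= (bil_Nl brB) ?opprK addrC ?opprD.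
Qed.

Lemma conj_bracket_antilinear_r x y :
  conj_bracket br x (tensorJ h y) = - tensorJ h (conj_bracket br x y).
Proof.
have cB := conj_bracket_bilinear (lie_bilinear br_lie).
have anti := alternating_anticomm cB conj_bracket_alternating.
by rewrite anti conj_bracket_antilinear_l [conj_bracket br x y]anti (linearN (tensorJ h)).
Qed.

End ConjBracket.

Theorem proposition4p4 (R : realType) (h : vectType R) (br : h -> h -> h)
    (br_lie : lie_bracket br) (br_nil : two_step_nilpotent br) :
  quasi_Kaehler_Chern_flat (conj_bracket br) (tensorJ h).
Proof.
apply: antilinear_bracket_quasi_Kaehler_Chern_flat.
- split; first exact: conj_bracket_lie.
  apply/lfunP => z; rewrite comp_lfunE opp_lfunE id_lfunE !lfunE /= !tensorJ_funE.
  by apply: tensorC_eq.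
- exact: conj_bracket_antilinear_l.
- exact: conj_bracket_antilinear_r.
Qed.
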